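(* Let $n\ge2$. a) $\tilde N_n^+$ is invariant under the mappings $M\mapsto M'$ and $M\mapsto M''$; that is, if $M\in\tilde N_n^+$, then $M',M''\in\tilde N_n^+$. b) For every $M\in\tilde N_n^+$, $$\bigl((M')''\bigr)'=\bigl((M'')'\bigr)''.$$
   Context: Matrices: $B_n$ is the group of $n\times n$ real invertible upper triangular matrices and $N_n\subset B_n$ its unipotent subgroup (ones on the diagonal). $G\in B_n$ is totally positive if every minor of $G$ that does not vanish identically (as a function on $B_n$) is positive. $N_n^+\subset N_n$ is the subset of totally positive matrices. Jacobi coordinates: for $1\le k\le n-1$, $J_k(x)=\exp(xe_k)\in N_n$ with $(e_k)_{ij}=\delta_{ik}\delta_{j,k+1}$. It is known that every $M\in N_n^+$ has a unique representation $M=\mathbb J_1\cdots\mathbb J_{n-1}$, $\mathbb J_k=J_k(x_{1,k+1})J_{k-1}(x_{2,k+1})\cdots J_1(x_{k,k+1})$, with positive reals $x_{ij}=x_{ij}(M)$, $1\le i<j\le n$ (the Jacobi coordinates of $M$), and conversely every such product lies in $N_n^+$. Maps $M\mapsto M',M''$: let $P$ be the $n\times n$ matrix with $P_{ij}=\delta_{i+j,n+1}$. For every $M\in N_n^+$ there exist unique $M',M''\in N_n^+$ and a unique diagonal matrix $D_M$ such that $PMP=M'PD_MM''$. $\tilde N_n^+$ is the set of $M\in N_n^+$ whose Jacobi coordinates satisfy $$\prod_{k=i+1}^n\frac{x_{ik}(M)}{x_{n+1-k,n+1-i}(M)}=\prod_{k=1}^{i-1}\frac{x_{ki}(M)}{x_{n+1-i,n+1-k}(M)}$$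 for all integers $1\le i<n/2$ (empty products equal $1$). *)

(* Defs.v *)
From HB Require Import structures.
From mathcomp Require Import all_boot all_order all_algebra.
From mathcomp Require Import all_classical all_reals all_analysis.

Set Implicit Arguments.
Unset Strict Implicit.
Unset Printing Implicit Defensive.

Import Order.TTheory GRing.Theory Num.Theory.
Import numFieldNormedType.Exports.

Local Open Scope classical_set_scope.
Local Open Scope ring_scope.

(* Matrix entries are indexed from 0 by 'I_n, so the mathematical index of
   i : 'I_n is i.+1.  Coordinates x_ij and the index k of e_k, J_k are plain
   natural numbers and keep the mathematical 1-based numbering. *)

Definition Bn (R : realType) (n : nat) : set 'M[R]_n :=
  [set G : 'M[R]_n | (forall i j : 'I_n, (j < i)%N -> G i j = 0) /\ G \in unitmx].

Definition Nn (R : realType) (n : nat) : set 'M[R]_n :=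
  [set G : 'M[R]_n | Bn G /\ forall i : 'I_n, G i i = 1].

(* A minor of order k is given by strictly increasing row and column
   selections f, g : 'I_k -> 'I_n. *)
Definition totally_positive (R : realType) (n : nat) (G : 'M[R]_n) : Prop :=
  Bn G /\
  forall (k : nat) (f g : 'I_k -> 'I_n),
    {homo f : i j / (i < j)%N} -> {homo g : i j / (i < j)%N} ->
    (exists H : 'M[R]_n, Bn H /\ \det (mxsub f g H) != 0) ->
    0 < \det (mxsub f g G).

Definition Nn_pos (R : realType) (n : nat) : set 'M[R]_n :=
  [set M : 'M[R]_n | Nn M /\ totally_positive M].

(* The series converges entrywise for every A. *)
Definition mxexp (R : realType) (n : nat) (A : 'M[R]_n) : 'M[R]_n :=
  \matrix_(i, j) limn (series (fun m : nat => ((m`!)%:R^-1 *: A ^+ m) i j)).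

Definition e_mx (R : realType) (n k : nat) : 'M[R]_n :=
  \matrix_(i, j) ((i.+1 == k) && (j.+1 == k.+1))%:R.

Definition J_mx (R : realType) (n k : nat) (x : R) : 'M[R]_n :=
  mxexp (x *: e_mx R n k).

(* Big products in the ring 'M_n are ordered from left to right, so this is
   J_k(x_{1,k+1}) J_{k-1}(x_{2,k+1}) ... J_1(x_{k,k+1}). *)
Definition JJ (R : realType) (n : nat) (x : nat -> nat -> R) (k : nat) :
    'M[R]_n :=
  \prod_(1 <= l < k.+1) J_mx n (k.+1 - l) (x l k.+1).

(* x i j is meaningful only for 1 <= i < j <= n. *)
Definition jacobi_coordinates (R : realType) (n : nat) (M : 'M[R]_n)
    (x : nat -> nat -> R) : Prop :=
  (forall i j : nat, (1 <= i)%N -> (i < j)%N -> (j <= n)%N -> 0 < x i j) /\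
  M = \prod_(1 <= k < n) JJ n x k.

Definition Nn_tilde (R : realType) (n : nat) : set 'M[R]_n :=
  [set M : 'M[R]_n | Nn_pos M /\
    exists x : nat -> nat -> R, jacobi_coordinates M x /\
      forall i : nat, (1 <= i)%N -> (i.*2 < n)%N ->
        \prod_(i.+1 <= k < n.+1) (x i k / x (n.+1 - k)%N (n.+1 - i)%N) =
        \prod_(1 <= k < i) (x k i / x (n.+1 - i)%N (n.+1 - k)%N)].

Definition Pmx (R : realType) (n : nat) : 'M[R]_n :=
  \matrix_(i, j) ((i.+1 + j.+1)%N == n.+1)%:R.

(* A and B play the roles of M' and M''. *)
Definition prime_factors (R : realType) (n : nat) (M A B : 'M[R]_n) : Prop :=
  [/\ Nn_pos A, Nn_pos B &
      exists D : 'M[R]_n, is_diag_mx D /\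
        Pmx R n *m M *m Pmx R n = A *m Pmx R n *m D *m B].

(* The maps M |-> M' and M |-> M'' are made total by the value 0, which is
   used only when no factorization exists. *)
Definition mx_prime (R : realType) (n : nat) (M : 'M[R]_n) : 'M[R]_n :=
  xget 0 [set A | exists B : 'M[R]_n, prime_factors M A B].

Definition mx_dprime (R : realType) (n : nat) (M : 'M[R]_n) : 'M[R]_n :=
  xget 0 [set B | exists A : 'M[R]_n, prime_factors M A B].

(* Main.v *)
(* Multiplying P M P = M' P D M'' by P turns it into the Gauss decomposition
   M P = (P M' P) D M''.  Rearranging it shows (M')' = M, (M'')'' = M,
   (M')'' = D (M'')^-1 D^-1 and that D is inverted by both maps, whence
   ((M')'')' = (P D P) M^-1 (P D P)^-1 and ((M'')')'' = D^-1 M^-1 D.  These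
   agree as soon as D (P D P) is scalar.  The minor of M on the first k rows and
   the last k columns is the monomial \prod_(l <= k < j) x_lj, so that
   D_i = (-1)^(i-1) \prod_(j > i) x_ij / \prod_(l < i) x_li, and the condition
   defining \tilde N_n^+ reads D_i D_(n+1-i) = (-1)^(n-1): it implies the
   equality and is invariant under D |-> D^-1.

   The factors are totally positive because (up to conjugation by P) all their
   minors on initial columns are positive ratios of minors of M; this suffices
   to peel off the Jacobi factors one by one, and a product of Jacobi factors is
   totally positive by multilinearity of the minors in their columns. *)

Require Import Defs.
From HB Require Import structures.
From mathcomp Require Import all_boot all_order all_algebra all_fingroup.
From mathcomp Require Import all_classical all_reals all_analysis.
From mathcomp Require Import zify ring.

Import Order.TTheory GRing.Theory Num.Theory.
Import numFieldNormedType.Exports.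

Local Open Scope classical_set_scope.
Local Open Scope ring_scope.

Set Implicit Arguments.
Unset Strict Implicit.
Unset Printing Implicit Defensive.

(** * Minors and products of Jacobi factors *)

Definition incr (k : nat) (f : 'I_k -> nat) := {homo f : i j / (i < j)%N}.

Definition minor (R : comNzRingType) (A : nat -> nat -> R) (k : nat)
    (f g : 'I_k -> nat) : R := \det (\matrix_(i, j) A (f i) (g j)).

Definition lower (R : comNzRingType) (A : nat -> nat -> R) :=
  forall i j, (i < j)%N -> A i j = 0.

Lemma incr_leq (k : nat) (f : 'I_k -> nat) (i j : 'I_k) :
  incr f -> (i <= j)%N -> (f i <= f j)%N.
Proof.
move=> hf; rewrite leq_eqVlt => /orP[/eqP/val_inj -> //|/hf]; exact: ltnW.
Qed.

(** A permutation cannot send the indices up to [m] into the fewer indices below [m]. So every term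
    of the Leibniz expansion has a factor with row at most [f m] and column at least [g m], hence
    above the diagonal. *)
Lemma minor_lower0 (R : comNzRingType) (A : nat -> nat -> R) (k : nat)
    (f g : 'I_k -> nat) (m : 'I_k) :
  lower A -> incr f -> incr g -> (f m < g m)%N -> minor A f g = 0.
Proof.
move=> hA hf hg hm; rewrite /minor /determinant big1 // => s _.
suff [i im sm] : exists2 i : 'I_k, (i <= m)%N & (m <= s i)%N.
  rewrite (bigD1 i) //= mxE hA ?mul0r ?mulr0 //.
  exact: leq_ltn_trans (incr_leq hf im) (leq_trans hm (incr_leq hg sm)).
apply: contrapT => H.
pose S := [set i : 'I_k | (i <= m)%N]%SET.
have sub : (s @: S \subset [set i : 'I_k | (i < m)%N])%SET.
  apply/fintype.subsetP => _ /imsetP[i iS ->]; rewrite inE ltnNge; apply/negP => mi.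
  by apply: H; exists i => //; rewrite inE in iS.
have := fintype.subset_leq_card sub.
rewrite card_imset; last exact: perm_inj.
have -> : S = (m |: [set i : 'I_k | (i < m)%N])%SET.
  by apply/finset.setP => i; rewrite !inE leq_eqVlt.
by rewrite cardsU1 inE ltnn add1n ltnn.
Qed.

Lemma minor_mul (R : comNzRingType) (A B : nat -> nat -> R) (k : nat)
    (f g h : 'I_k -> nat) (T : 'M[R]_k) :
  (forall i j, A (f i) (h j) = \sum_l B (f i) (g l) * T l j) ->
  minor A f h = minor B f g * \det T.
Proof.
move=> E; rewrite /minor -det_mulmx; congr (\det _).
by apply/matrixP => i j; rewrite !mxE E; apply: eq_bigr => l _; rewrite mxE.
Qed.

Definition mix (R : comNzRingType) (k : nat) (U V : 'M[R]_k) (S : pred 'I_k) : 'M[R]_k :=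
  \matrix_(i, j) if S j then U i j else V i j.

(** By multilinearity in the columns, [\det (U + V)] is the sum of [\det (mix U V S)] over all
    column sets [S]; nonnegative terms are bounded by their sum. *)
Lemma det_mix_le (R : realFieldType) (k : nat) (U V : 'M[R]_k) :
  (forall S, 0 <= \det (mix U V S)) ->
  forall S, \det (mix U V S) <= \det (U + V).
Proof.
move=> H.
(* The first [m] columns are already summed and the others still follow [S]: [D] interpolates
   between [mix U V S] and [U + V]. *)
pose D m S : 'M[R]_k := \matrix_(i, j)
  if (j < m)%N then U i j + V i j else if S j then U i j else V i j.
have Dstep m S (mk : (m < k)%N) : \det (D m.+1 S) =
    \det (D m (fun j : 'I_k => (j == m :> nat) || S j)) +
    \det (D m (fun j : 'I_k => (j != m :> nat) && S j)).
  have E b c (x y z : 'M[R]_k) : row (Ordinal mk) x^T = b *: row (Ordinal mk) y^T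
      + c *: row (Ordinal mk) z^T ->
      row' (Ordinal mk) x^T = row' (Ordinal mk) y^T ->
      row' (Ordinal mk) x^T = row' (Ordinal mk) z^T ->
      \det x = b * \det y + c * \det z.
    rewrite -(det_tr x) -(det_tr y) -(det_tr z) => h1 h2 h3.
    exact: (determinant_multilinear h1 (esym h2) (esym h3)).
  have := E 1 1 (D m.+1 S) (D m (fun j : 'I_k => (j == m :> nat) || S j))
    (D m (fun j : 'I_k => (j != m :> nat) && S j)).
  rewrite !mul1r; apply.
  - by apply/rowP => i; rewrite !mxE !mul1r /= ltnn ltnSn eqxx.
  - apply/matrixP => i j; rewrite !mxE.
    have ne : (lift (Ordinal mk) i != m :> nat)%N.
      by have := neq_lift (Ordinal mk) i; rewrite -val_eqE eq_sym.
    by rewrite ltnS leq_eqVlt (negbTE ne).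
  - apply/matrixP => i j; rewrite !mxE.
    have ne : (lift (Ordinal mk) i != m :> nat)%N.
      by have := neq_lift (Ordinal mk) i; rewrite -val_eqE eq_sym.
    by rewrite ltnS leq_eqVlt (negbTE ne).
have main m : (m <= k)%N -> forall S,
    0 <= \det (D m S) /\ \det (mix U V S) <= \det (D m S).
  elim: m => [_ S|m IH mk S].
    have -> : D 0%N S = mix U V S by apply/matrixP => i j; rewrite !mxE.
    by rewrite H lexx.
  rewrite Dstep //; have {}IH := IH (ltnW mk).
  split.
    by rewrite addr_ge0 //; case: (IH (fun j : 'I_k => (j == m :> nat) || S j));
      case: (IH (fun j : 'I_k => (j != m :> nat) && S j)).
  have mixE S' : (forall j, S' j = S j) -> mix U V S' = mix U V S.
    by move=> e; apply/matrixP => i j; rewrite !mxE e.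
  have [Sm|Sm] := boolP (S (Ordinal mk)).
    have [h0 _] := IH (fun j : 'I_k => (j != m :> nat) && S j).
    have [_] := IH (fun j : 'I_k => (j == m :> nat) || S j).
    rewrite mixE => [h|j]; first by rewrite -[leLHS]addr0 lerD.
    by case: eqP => //= e; rewrite -Sm; congr (S _); exact: val_inj.
  have [h0 _] := IH (fun j : 'I_k => (j == m :> nat) || S j).
  have [_] := IH (fun j : 'I_k => (j != m :> nat) && S j).
  rewrite mixE => [h|j]; first by rewrite -[leLHS]add0r lerD.
  case: eqP => //= e; apply/esym/negbTE; move: Sm; congr (~~ S _).
  exact: val_inj.
move=> S; have [_] := main k (leqnn k) S.
by have -> : D k S = U + V by apply/matrixP => i j; rewrite !mxE ltn_ord.
Qed.

(* [jac x n] is the product of the Jacobi factors JJ_1 ... JJ_(n-1), read from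
   its lower right corner: the entry (i, j) of the product is the entry
   (n-1-i, n-1-j) of [jac x n]; only indices below [n] are meaningful. *)
Fixpoint jac (R : comNzRingType) (x : nat -> nat -> R) (n i j : nat) : R :=
  match n, i with
  | n'.+1, i'.+1 => jac x n' i' j * x j.+1 n'.+1
                    + (if j is j'.+1 then jac x n' i' j' else 0)
  | _, _ => (i == j)%:R
  end.
Arguments jac : simpl nomatch.

Lemma jac_lower (R : comNzRingType) (x : nat -> nat -> R) n : lower (jac x n).
Proof.
elim: n => [|n IH] [|i] [|j] //= ij; first by rewrite ltn_eqF.
by rewrite !IH ?mul0r ?addr0 // ltnW.
Qed.

Lemma jac_diag (R : comNzRingType) (x : nat -> nat -> R) n i : jac x n i i = 1.
Proof.
elim: n i => [|n IH] [|i] //=; first by rewrite eqxx.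
by rewrite jac_lower ?mul0r ?add0r.
Qed.

Lemma eq_jac (R : comNzRingType) (x y : nat -> nat -> R) n :
  (forall i j, (j <= n)%N -> x i j = y i j) -> jac x n =2 jac y n.
Proof.
elim: n => [|n IH] xy [|i] j //=.
have {}IH := IH (fun i j jn => xy i j (leqW jn)).
by rewrite IH xy //; case: j => [|j]; rewrite ?IH.
Qed.

Lemma minor_cons (R : comNzRingType) (A : nat -> nat -> R) (k : nat)
    (f g : 'I_k.+1 -> nat) :
  (forall j, A (f ord0) (g j) = (j == ord0)%:R) ->
  minor A f g = minor A (f \o lift ord0) (g \o lift ord0).
Proof.
move=> E; rewrite /minor (expand_det_row _ ord0) big_ord_recl big1 => [|j _].
  rewrite mxE E eqxx mul1r addr0 /cofactor expr0 mul1r; congr (\det _).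
  by apply/matrixP => i j; rewrite !mxE.
by rewrite mxE E mul0r.
Qed.

Lemma minor_eqcol0 (R : comNzRingType) (A : nat -> nat -> R) (k : nat)
    (f g : 'I_k -> nat) (i j : 'I_k) : i != j -> g i = g j -> minor A f g = 0.
Proof.
move=> ij e; rewrite /minor -det_tr; apply: (determinant_alternate ij) => l.
by rewrite !mxE e.
Qed.

(** Each column of the minor is a positive multiple of column [g j] plus column [g j - 1] of the
    smaller product. Expanding gives nonnegative terms by induction on [n], and one of them is
    positive. *)
Lemma minor_jac_gt0 (R : realFieldType) (x : nat -> nat -> R) n k (f g : 'I_k -> nat) :
  (forall i j, 0 < x i j) -> incr f -> incr g ->
  (forall i, f i < n)%N -> (forall i, g i <= f i)%N -> 0 < minor (jac x n) f g.
Proof.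
move=> x0; elim: n => [|n IH] in k f g *.
  case: k f g => [|k] f g _ _ fn _; first by rewrite /minor det_mx00.
  by have := fn ord0.
move=> fi gi fn gf.
have IH0 k' (f' g' : 'I_k' -> nat) : incr f' -> incr g' ->
    (forall i, f' i < n)%N -> 0 <= minor (jac x n) f' g'.
  move=> f'i g'i f'n.
  have [/forallP gf'|/forallPn[i]] := boolP [forall i, (g' i <= f' i)%N].
    exact/ltW/IH.
  by rewrite -ltnNge => h; rewrite (minor_lower0 _ f'i g'i h) //; exact: jac_lower.
(* Row [0] can only come first; it is then a unit vector, and expanding along it leaves rows to
   which the recursion of [jac] applies. *)
wlog f0 : k f g fi gi fn gf / forall i, (0 < f i)%N.
  move=> W; case: k f g fi gi fn gf => [|k] f g fi gi fn gf.
    by rewrite /minor det_mx00.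
  have [f0|f0] := posnP (f ord0); last first.
    by apply: W => // i; apply: leq_trans f0 (incr_leq fi _).
  rewrite minor_cons => [|j].
    have fl i : (0 < f (lift ord0 i))%N by rewrite -[X in (X < _)%N]f0; exact: fi.
    by apply: W => //; [move=> i j ij; exact: fi | move=> i j ij; exact: gi |
      move=> i; exact: fn | move=> i; exact: gf].
  rewrite f0 /=; congr (_%:R); have g0 : g ord0 = 0%N.
    by apply/eqP; rewrite -leqn0 -f0.
  case: (unliftP ord0 j) => [j' ->|->]; last by rewrite g0 !eqxx.
  have : (0 < g (lift ord0 j'))%N by rewrite -[X in (X < _)%N]g0; exact: gi.
  by case: (g _) => // m _; rewrite eq_sym -val_eqE.
pose f' i := (f i).-1.
have f'i : incr f' by move=> i j /fi; rewrite /f'; move: (f0 i) (f0 j); lia.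
have f'n i : (f' i < n)%N by move: (fn i) (f0 i); rewrite /f'; lia.
pose U : 'M[R]_k := \matrix_(i, j) (jac x n (f' i) (g j) * x (g j).+1 n.+1).
pose V : 'M[R]_k := \matrix_(i, j) (if g j is c.+1 then jac x n (f' i) c else 0).
have -> : minor (jac x n.+1) f g = \det (U + V).
  congr (\det _); apply/matrixP => i j; rewrite !mxE.
  by rewrite -[f i]prednK //.
pose gS (S : pred 'I_k) j := if S j then g j else (g j).-1.
have mixE S : (forall j, S j || (0 < g j)%N) ->
    \det (mix U V S) = minor (jac x n) f' (gS S) *
      \prod_j (if S j then x (g j).+1 n.+1 else 1).
  move=> h; rewrite -[X in _ * X](_ : \det (diag_mx
    (\row_j (if S j then x (g j).+1 n.+1 else 1))) = _); last first.
    by rewrite det_diag; apply: eq_bigr => j _; rewrite mxE.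
  rewrite -det_mulmx; congr (\det _); apply/matrixP => i j.
  rewrite mul_mx_diag !mxE /gS; have := h j; case: (S j) => //=.
  by case: (g j) => //= c _; rewrite mulr1.
have prod0 S : 0 < \prod_j (if S j then x (g j).+1 n.+1 else 1).
  by apply: prodr_gt0 => j _; case: ifP.
(* A choice [S] contributes zero if it shifts column [0] or repeats a column; otherwise [gS S] is
   again increasing, as shifts are by one. *)
have ge0 S : 0 <= \det (mix U V S).
  have [/forallP h|/forallPn[j]] := boolP [forall j, S j || (0 < g j)%N]; last first.
    rewrite negb_or lt0n negbK => /andP[Sj /eqP gj].
    rewrite (expand_det_col _ j) big1 // => i _.
    by rewrite !mxE (negbTE Sj) gj mul0r.
  rewrite mixE //; apply: mulr_ge0; last exact: ltW.
  have [/existsP[i /existsP[j /andP[ij /eqP e]]]|/existsPn h2] :=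
      boolP [exists i, exists j, (i != j) && (gS S i == gS S j)].
    by rewrite (minor_eqcol0 _ _ ij e).
  apply: IH0 => // i j ij.
  have : gS S i != gS S j.
    have /existsPn/(_ j) := h2 i; rewrite negb_and negbK => /orP[/eqP e|//].
    by rewrite e ltnn in ij.
  have := gi _ _ ij; have := h j; rewrite /gS; case: (S i); case: (S j) => /=; lia.
(* The positive term: shifting exactly the columns with [g j = f j] keeps them increasing and at
   most [f' j]. *)
apply: lt_le_trans (det_mix_le ge0 (fun j => (g j < f j)%N)).
rewrite mixE => [|j]; last by case: ltnP => //=; exact: leq_trans (f0 j).
apply: mulr_gt0 => //; apply: IH => //.
  move=> i j ij; have := gi _ _ ij; have := fi _ _ ij; have := gf i; have := gf j.
  have := f0 i; have := f0 j; rewrite /gS /=.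
  by case: (ltnP (g i) (f i)); case: (ltnP (g j) (f j)) => /=; lia.
move=> i; have := gf i; have := f0 i; rewrite /gS /f' /=.
by case: (ltnP (g i) (f i)) => /=; lia.
Qed.

(** * Gauss decomposition and existence of Jacobi coordinates *)

(** The decomposition is bordered by one row and one column at a time, the leading block being
    invertible by hypothesis. *)
Lemma ldu_exists (F : fieldType) (A : nat -> nat -> F) (n : nat) :
  (forall k, (k <= n)%N -> \det (\matrix_(i < k, j < k) A i j) != 0) ->
  exists (L : nat -> nat -> F) (d : nat -> F) (U : nat -> nat -> F),
    [/\ lower L, (forall i, L i i = 1), lower (fun i j => U j i),
    (forall i, U i i = 1) &
    forall i j, (i < n)%N -> (j < n)%N ->
      A i j = \sum_(l < n) L i l * d l * U l j].
Proof.
elim: n => [_|n IH Adet].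
  exists (fun i j => (i == j)%:R), (fun _ => 1), (fun i j => (i == j)%:R).
  split => // [i j /ltn_eqF ->//|i|i j /gtn_eqF ->//|i]; by rewrite eqxx.
have [|L [d [U [Ll L1 Ul U1 E]]]] := IH; first by move=> k kn; apply: Adet; exact: leqW.
pose M := \matrix_(i < n, j < n) A i j.
have Mu : M \in unitmx by rewrite unitmxE unitfE; exact: Adet (leqnSn n).
(* [r] and [s] express the new row and column of [A] through the old ones; the same combinations of
   the rows of [L] and the columns of [U] extend these, and the new pivot [d' n] is the Schur
   complement. *)
pose r := (\row_(j < n) A n j) *m invmx M.
pose s := invmx M *m (\col_(i < n) A i n).
pose L' (i j : nat) := if i == n then if (j < n)%N then \sum_(p < n) r 0 p * L p j else (j == n)%:R
  else L i j.
pose U' (i j : nat) := if j == n then if (i < n)%N then \sum_(p < n) U i p * s p 0 else (i == n)%:R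
  else U i j.
pose d' (l : nat) := if l == n then A n n - \sum_(l < n) L' n l * d l * U' l n else d l.
exists L', d', U'; split.
- move=> i j ij; rewrite /L'; case: eqP => [e|_]; last exact: Ll.
  by move: ij; rewrite e => ij; rewrite ltnNge (ltnW ij) gtn_eqF.
- by move=> i; rewrite /L'; case: eqP => [->|_]; rewrite ?ltnn ?eqxx.
- move=> j i ij; rewrite /U'; case: eqP => [e|_]; last exact: Ul.
  by move: ij; rewrite e => ij; rewrite ltnNge (ltnW ij) gtn_eqF.
- by move=> i; rewrite /U'; case: eqP => [->|_]; rewrite ?ltnn ?eqxx.
move=> i j; rewrite !ltnS big_ord_recr /= => ilen jlen.
have dE (l : 'I_n) : d' l = d l by rewrite /d' ltn_eqF.
under eq_bigr => l _ do rewrite dE.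
have [->|ni] := eqVneq i n; have [->|nj] := eqVneq j n.
- by rewrite {2}/L' {2}/U' {1}/d' !eqxx ltnn mul1r mulr1 addrC subrK.
- have jn : (j < n)%N by rewrite ltn_neqAle nj.
  rewrite [U' n j]/U' (negbTE nj) Ul // mulr0 addr0.
  under eq_bigr => l _ do rewrite /L' /U' eqxx ltn_ord (negbTE nj) -mulrA mulr_suml.
  rewrite exchange_big /=.
  have := congr1 (fun m : 'rV_n => m 0 (Ordinal jn)) (mulmxKV Mu (\row_(j < n) A n j)).
  rewrite -/r mxE [RHS]mxE => <-; apply: eq_bigr => p _; rewrite [M _ _]mxE E // mulr_sumr.
  by apply: eq_bigr => l _; ring.
- have iltn : (i < n)%N by rewrite ltn_neqAle ni.
  rewrite [L' i n]/L' (negbTE ni) Ll // !mul0r addr0.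
  under eq_bigr => l _ do rewrite /L' /U' eqxx ltn_ord (negbTE ni) mulr_sumr.
  rewrite exchange_big /=.
  have := congr1 (fun m : 'cV_n => m (Ordinal iltn) 0) (mulKVmx Mu (\col_(i < n) A i n)).
  rewrite -/s mxE [RHS]mxE => <-; apply: eq_bigr => p _; rewrite [M _ _]mxE E // mulr_suml.
  by apply: eq_bigr => l _; ring.
- rewrite [L' i n]/L' (negbTE ni) Ll ?ltn_neqAle ?ni // !mul0r addr0.
  rewrite E ?ltn_neqAle ?ni ?nj //; apply: eq_bigr => l _.
  by rewrite /L' /U' (negbTE ni) (negbTE nj).
Qed.

(** As [U] is upper triangular, the first [k] columns of [A] involve only the first [k] columns of
    [L], through a triangular matrix with diagonal [d]. *)
Lemma minor_ldu (F : comNzRingType) (A L U : nat -> nat -> F) (d : nat -> F)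
    (n k : nat) (f : 'I_k -> nat) :
  lower (fun i j => U j i) -> (forall i, U i i = 1) ->
  (forall i j, (i < n)%N -> (j < n)%N ->
      A i j = \sum_(l < n) L i l * d l * U l j) ->
  (k <= n)%N -> (forall i, f i < n)%N ->
  minor A f (@nat_of_ord k) = minor L f (@nat_of_ord k) * \prod_(l < k) d l.
Proof.
move=> Ul U1 E kn fn.
rewrite (minor_mul (B := L) (g := @nat_of_ord k)
  (T := \matrix_(l, j) (d l * U l j))) => [|i j].
  congr (_ * _); rewrite -det_tr det_trig.
    by apply: eq_bigr => l _; rewrite !mxE U1 mulr1.
  by apply/is_trig_mxP => i j ij; rewrite !mxE Ul ?mulr0.
have jn := leq_trans (ltn_ord j) kn.
rewrite E //; under [RHS]eq_bigr => l _ do rewrite mxE mulrA.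
rewrite (big_ord_widen _ (fun l => L (f i) l * d l * U l j) kn) [RHS]big_mkcond.
apply: eq_bigr => l _; case: ltnP => // kl.
by rewrite Ul ?mulr0 //; exact: leq_trans kl.
Qed.

(* Factoring [A (i + 1) j] as L D U, the triangular shape of [A] forces D U to
   be bidiagonal; D is the new column of coordinates and L the smaller matrix. *)
Lemma jac_exists (R : realFieldType) (A : nat -> nat -> R) (n : nat) :
  lower A -> (forall i, A i i = 1) ->
  (forall k (f : 'I_k -> nat), (k <= n)%N -> incr f -> (forall i, f i < n)%N ->
    0 < minor A f (@nat_of_ord k)) ->
  exists2 x : nat -> nat -> R, (forall i j, 0 < x i j) &
    forall i j, (i < n)%N -> (j < n)%N -> A i j = jac x n i j.
Proof.
elim: n A => [|n IH] A Al A1 Apos; first by exists (fun _ _ => 1) => *; rewrite ?ltr01.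
pose S i j := A i.+1 j.
have Spos k (f : 'I_k -> nat) : (k <= n)%N -> incr f -> (forall i, f i < n)%N ->
    0 < minor S f (@nat_of_ord k).
  move=> kn fi fn; apply: (Apos k (fun i => (f i).+1)) => //; first exact: leqW.
have idi k : incr (@nat_of_ord k) by [].
have [|L [d [U [Ll L1 Ul U1 E]]]] := @ldu_exists _ S n.
  move=> k kn; apply: lt0r_neq0; apply: (Spos k) => // i; exact: leq_trans kn.
have prodE k (f : 'I_k -> nat) : (k <= n)%N -> (forall i, f i < n)%N ->
    minor S f (@nat_of_ord k) = minor L f (@nat_of_ord k) * \prod_(l < k) d l.
  by move=> kn fn; apply: minor_ldu E _ _.
have prod0 k : (k <= n)%N -> 0 < \prod_(l < k) d l.
  move=> kn; have kl (i : 'I_k) : (i < n)%N by exact: leq_trans kn.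
  have := Spos k _ kn (@idi k) kl; rewrite prodE // [minor L _ _]det_trig.
    by rewrite big1 ?mul1r // => i _; rewrite mxE.
  by apply/is_trig_mxP => i j ij; rewrite mxE Ll.
have d0 l : (l < n)%N -> 0 < d l.
  move=> ln; have := prod0 _ ln; rewrite big_ord_recr /=.
  by rewrite pmulr_rgt0 // prod0 // ltnW.
(* Above the diagonal, [D U] agrees with [S], whose entries there are 1 next to the diagonal and 0
   beyond: forward substitution in the unitriangular [L]. *)
have T0 j : (j < n)%N -> forall l, (l < j)%N -> d l * U l j = (l.+1 == j)%:R.
  move=> jn; elim/ltn_ind => l IHl lj; have ln := ltn_trans lj jn.
  have : S l j = (l.+1 == j)%:R.
    rewrite /S; have [->|ne] := eqVneq l.+1 j; first exact: A1.
    by rewrite Al // ltn_neqAle ne.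
  rewrite E // (bigD1 (Ordinal ln)) //= L1 mul1r big1 ?addr0 // => p.
  rewrite -val_eqE /= => pl; have [lp|pl'] := ltnP l p; first by rewrite Ll ?mul0r.
  have {pl pl'}pl : (p < l)%N by rewrite ltn_neqAle pl.
  rewrite -mulrA IHl //; last exact: ltn_trans pl lj.
  by rewrite (_ : p.+1 == j = false) ?mulr0 //; apply/eqP; lia.
have SE i j : (i < n)%N -> (j < n)%N ->
    S i j = L i j * d j + if j is j'.+1 then L i j' else 0.
  move=> ilen jn; rewrite E // (bigD1 (Ordinal jn)) //= U1 mulr1; congr (_ + _).
  case: j jn => [|j] jn.
    rewrite big1 // => l; rewrite -val_eqE /= -lt0n => l0.
    by rewrite Ul ?mulr0.
  rewrite (bigD1 (Ordinal (ltnW jn))) /=; last by apply/eqP => /(congr1 val) /=; lia.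
  rewrite -mulrA T0 // eqxx mulr1 big1 ?addr0 // => l.
  rewrite -!val_eqE /= => /andP[lj lj'].
  case: (ltngtP l j.+1) lj => // [lj|lj] _; last by rewrite Ul ?mulr0.
  by rewrite -mulrA T0 // eqSS (negbTE lj') mulr0.
have [x x0 xE] : exists2 x : nat -> nat -> R, (forall i j, 0 < x i j) &
    forall i j, (i < n)%N -> (j < n)%N -> L i j = jac x n i j.
  apply: IH => // k f kn fi fn.
  by have := Spos k f kn fi fn; rewrite prodE // pmulr_lgt0 // prod0.
(* The pivots become coordinate column [n.+1], shifted to 1-based numbering; the default 1 beyond
   their range keeps [y] positive everywhere. *)
pose y i j := if j == n.+1 then if (i.-1 < n)%N then d i.-1 else 1 else x i j.
exists y => [i j|i j]; first by rewrite /y; case: eqP => // _; case: ltnP => // /d0.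
have ejac : jac y n =2 jac x n.
  by apply: eq_jac => a b bn; rewrite /y ltn_eqF.
have [ij|ji|->] := ltngtP i j; last by rewrite A1 jac_diag.
  by rewrite Al // jac_lower.
case: i ji => // i ji; rewrite ltnS => ilen _ /=; rewrite !ejac.
have jn : (j < n)%N by exact: leq_trans ilen.
rewrite -[LHS]/(S i j) SE // xE // /y eqxx /= jn; case: (j) jn => // j' jn.
by rewrite ejac xE // ltnW.
Qed.

(** * Corner minors as monomials in the coordinates *)

Lemma mul_Pmx (R : realType) (m n : nat) (M : 'M[R]_(m, n)) i j :
  (Pmx R m *m M) i j = M (rev_ord i) j.
Proof.
rewrite mxE (bigD1 (rev_ord i)) //= mxE big1 ?addr0 => [|l ne].
  have -> : (i.+1 + (rev_ord i).+1 == m.+1)%N; last by rewrite mul1r.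
  by rewrite /=; have := ltn_ord i; lia.
rewrite mxE; case: eqP => [e|_]; last by rewrite mul0r.
by case/eqP: ne; apply: val_inj => /=; lia.
Qed.

Lemma mulmx_Pmx (R : realType) (m n : nat) (M : 'M[R]_(m, n)) i j :
  (M *m Pmx R n) i j = M i (rev_ord j).
Proof.
have PT : (Pmx R n)^T = Pmx R n by apply/matrixP => a b; rewrite !mxE addnC.
have -> : M *m Pmx R n = (Pmx R n *m M^T)^T by rewrite trmx_mul trmxK PT.
by rewrite mxE mul_Pmx mxE.
Qed.

Lemma PmxK (R : realType) (n : nat) : Pmx R n *m Pmx R n = 1%:M.
Proof.
apply/matrixP => i j; rewrite mul_Pmx !mxE -val_eqE /=; congr (_%:R).
by have := ltn_ord i; have := ltn_ord j; lia.
Qed.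

Lemma det_PmxS (R : realType) (k : nat) :
  \det (Pmx R k.+1) = (-1) ^+ k * \det (Pmx R k).
Proof.
rewrite (expand_det_col _ ord0) (bigD1 ord_max) //= big1 ?addr0 => [|i ne].
  rewrite mxE /= addn1 eqxx mul1r /cofactor addn0; congr (_ * \det _).
  apply/matrixP => i j; rewrite !mxE lift_max lift0; congr (_%:R); lia.
rewrite mxE; case: eqP => [e|_]; last by rewrite mul0r.
by case/eqP: ne; apply: val_inj; rewrite /= in e *; lia.
Qed.

Lemma det_Pmx_sqr (R : realType) (k : nat) : \det (Pmx R k) * \det (Pmx R k) = 1.
Proof. by rewrite -det_mulmx PmxK det1. Qed.

Lemma det_rev_cols (R : realType) (k : nat) (M : 'M[R]_k) :
  \det (\matrix_(i, j) M i (rev_ord j)) = \det M * \det (Pmx R k).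
Proof.
by rewrite -det_mulmx; congr (\det _); apply/matrixP => i j; rewrite mxE mulmx_Pmx.
Qed.

Lemma det_rev (R : realType) (k : nat) (M : 'M[R]_k) :
  \det (\matrix_(i, j) M (rev_ord i) (rev_ord j)) = \det M.
Proof.
have -> : \matrix_(i, j) M (rev_ord i) (rev_ord j) = Pmx R k *m M *m Pmx R k.
  by apply/matrixP => i j; rewrite mxE mulmx_Pmx mul_Pmx.
by rewrite !det_mulmx mulrAC det_Pmx_sqr mul1r.
Qed.

(* The rows are taken in reversed order: this is the leading minor of [M P]
   when [M] has coordinates [x]. *)
Definition corner (R : realType) (x : nat -> nat -> R) (n k : nat) : R :=
  minor (jac x n) (fun i : 'I_k => n.-1 - i)%N (@nat_of_ord k).

(** Since [k <= n], no row involved is row [0], so the recursion of [jac] factors the minor through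
    the bidiagonal matrix [T], whose determinant is the product of its diagonal. *)
Lemma cornerS (R : realType) (x : nat -> nat -> R) (n k : nat) : (k <= n)%N ->
  corner x n.+1 k = corner x n k * \prod_(j < k) x j.+1 n.+1.
Proof.
move=> kn; rewrite /corner.
pose T := \matrix_(l < k, j < k) (x j.+1 n.+1 *+ (l == j) + (l.+1 == j :> nat)%:R : R).
have -> : minor (jac x n.+1) (fun i : 'I_k => n.+1.-1 - i)%N (@nat_of_ord k) =
    minor (jac x n.+1) (fun i : 'I_k => (n.-1 - i).+1)%N (@nat_of_ord k).
  congr (\det _); apply/matrixP => i j; rewrite !mxE.
  by rewrite (_ : n.+1.-1 - i = (n.-1 - i).+1)%N //; have := ltn_ord i; lia.
rewrite (minor_mul (B := fun i => jac x n i.-1) (g := @nat_of_ord k) (T := T)) => [|i j] /=.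
  congr (_ * _); rewrite -det_tr det_trig; last first.
    apply/is_trig_mxP => i j ij; rewrite !mxE -val_eqE /= gtn_eqF // mulr0n add0r.
    by rewrite gtn_eqF // leqW.
  by apply: eq_bigr => j _; rewrite !mxE eqxx mulr1n gtn_eqF // addr0.
under eq_bigr => l _ do rewrite mxE mulrDr.
rewrite big_split /=; congr (_ + _).
  rewrite (bigD1 j) //= eqxx mulr1n big1 ?addr0 // => l ne.
  by rewrite (negbTE ne) mulr0n mulr0.
case: j => [[|j] jk] /=; first by rewrite big1 // => l _; rewrite mulr0.
rewrite (bigD1 (Ordinal (ltnW jk))) //= eqxx mulr1 big1 ?addr0 // => l ne.
by rewrite eqSS -(inj_eq val_inj) /= in ne *; rewrite (negbTE ne) mulr0.
Qed.

(** For [n = k] the minor is that of a unitriangular array with reversed rows; each further step in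
    [n] contributes one column of coordinates. *)
Lemma cornerE (R : realType) (x : nat -> nat -> R) (n k : nat) : (k <= n)%N ->
  corner x n k = \det (Pmx R k) * \prod_(k <= q < n) \prod_(j < k) x j.+1 q.+1.
Proof.
move=> kn; rewrite -(subnKC kn); elim: (n - k)%N => [|p IH]; last first.
  rewrite addnS cornerS ?leq_addr // IH big_nat_recr ?leq_addr //=.
  by rewrite mulrA.
rewrite addn0 big_geq // mulr1.
pose J := \matrix_(i < k, j < k) jac x k i j.
have J1 : \det J = 1.
  rewrite det_trig; first by rewrite big1 // => i _; rewrite mxE jac_diag.
  by apply/is_trig_mxP => i j ij; rewrite mxE jac_lower.
rewrite -[RHS]mulr1 -J1 -det_mulmx; congr (\det _); apply/matrixP => i j.
by rewrite mul_Pmx !mxE /=; congr (jac _ _ _ _); have := ltn_ord i; lia.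
Qed.

Lemma corner_neq0 (R : realType) (x : nat -> nat -> R) (n k : nat) :
  (forall i j, (1 <= i)%N -> (i < j)%N -> (j <= n)%N -> 0 < x i j) ->
  (k <= n)%N -> corner x n k != 0.
Proof.
move=> x0 kn; rewrite cornerE // mulf_neq0 //.
  by apply/eqP => e; have /eqP := det_Pmx_sqr R k; rewrite e mul0r eq_sym oner_eq0.
rewrite big_nat; apply/lt0r_neq0/prodr_gt0 => q /andP[kq qn].
by apply: prodr_gt0 => j _; apply: x0 => //; have := ltn_ord j; lia.
Qed.

(** For positive coordinates and [1 <= i <= n], this is the absolute value of the entry of [D_M] at
    the 1-based index [i]. *)
Definition hook (R : realType) (n : nat) (x : nat -> nat -> R) (i : nat) : R :=
  \prod_(i.+1 <= k < n.+1) x i k / \prod_(1 <= k < i) x k i.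

(** Consecutive monomials differ by row [k.+1] of the coordinates in the numerator and column [k.+1]
    in the denominator; the sign comes from [det_PmxS]. *)
Lemma corner_ratio (R : realType) (x : nat -> nat -> R) (n k : nat) :
  (forall i j, (1 <= i)%N -> (i < j)%N -> (j <= n)%N -> 0 < x i j) ->
  (k < n)%N ->
  corner x n k.+1 = corner x n k * ((-1) ^+ k * hook n x k.+1).
Proof.
move=> x0 kn; rewrite !cornerE // ?(ltnW kn) // det_PmxS.
rewrite [in RHS]big_ltn // /hook !big_add1 /=.
under eq_bigr => q _ do rewrite big_ord_recr /=.
rewrite big_split /= big_mkord.
have ne : \prod_(i < k) x i.+1 k.+1 != 0.
  by apply/prodf_neq0 => j _; apply/lt0r_neq0/x0 => //; have := ltn_ord j; lia.
by field.
Qed.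

(** * Entries of the Jacobi products *)

Lemma mxexp_nilp2 (R : realType) (n : nat) (A : 'M[R]_n) :
  A *m A = 0 -> mxexp A = 1%:M + A.
Proof.
move=> AA; apply/matrixP => i j; rewrite mxE.
apply: lim_near_cst => //; exists 2%N => // m /= m2.
case: m m2 => [|[|m]] // _; rewrite seriesEnat /= 2?big_nat_recl //.
rewrite big1_seq => [|l _]; rewrite ?addr0; last first.
  by rewrite !exprS mulrA -[A * A]/(A *m A) AA mul0r scaler0 mxE.
by rewrite fact0 (_ : 1`! = 1%N) // invr1 !scale1r expr0 expr1 [RHS]mxE.
Qed.

Lemma J_mxE (R : realType) (n k : nat) (x : R) :
  J_mx n k x = 1%:M + x *: e_mx R n k.
Proof.
rewrite /J_mx mxexp_nilp2 // -scalemxAl -scalemxAr scalerA.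
have -> : e_mx R n k *m e_mx R n k = 0; last by rewrite scaler0.
apply/matrixP => i j; rewrite !mxE big1 // => l _; rewrite !mxE.
by rewrite -natrM mulnb; case: andP => // -[/andP[_ /eqP e1] /andP[/eqP e2 _]]; lia.
Qed.

(** The product [e_a e_b] is nonzero only for [b = a + 1], whereas the indices decrease along [JJ];
    so only the identity and the linear terms survive. *)
Lemma JJ_entry (R : realType) (n : nat) (x : nat -> nat -> R) (k : nat) i j :
  JJ n x k i j = (i == j)%:R +
    (if (i.+1 == j :> nat) && (j <= k)%N then x (k.+1 - j)%N k.+1 else 0).
Proof.
have H p : (p <= k)%N -> \prod_(1 <= l < p.+1) J_mx n (k.+1 - l) (x l k.+1) =
    1%:M + \sum_(1 <= l < p.+1) x l k.+1 *: e_mx R n (k.+1 - l).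
  elim: p => [|p IH] pk; first by rewrite !big_geq ?addr0.
  rewrite big_nat_recr //= IH ?(ltnW pk) // J_mxE [in RHS]big_nat_recr //=.
  set S := \sum_(_ <= _ < _) _; set y := _ *: _.
  rewrite -[1%:M]/(1 : 'M[R]_n) mulrDr mulr1 mulrDl mul1r.
  suff -> : S * y = 0 by rewrite addr0 addrA.
  rewrite mulr_suml big_nat big1 // => l /andP[l1 lp].
  rewrite -[LHS]/(_ *m _) -scalemxAl -scalemxAr.
  have -> : e_mx R n (k.+1 - l) *m e_mx R n (k.+1 - p.+1) = 0.
    apply/matrixP => a b; rewrite !mxE big1 // => c _; rewrite !mxE.
    by rewrite -natrM mulnb; case: andP => // -[/andP[_ /eqP e1] /andP[/eqP e2 _]]; lia.
  by rewrite !scaler0.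
rewrite /JJ H // !mxE; congr (_ + _); rewrite summxE.
under eq_bigr => l _ do rewrite !mxE.
case: ifP => [/andP[/eqP ij jk]|nij].
  rewrite (bigD1_seq (k.+1 - j)%N) ?iota_uniq ?mem_index_iota //=; last by lia.
  rewrite (_ : (i.+1 == k.+1 - (k.+1 - j))%N && _ = true); last by lia.
  rewrite mulr1 big_nat_cond big1 ?addr0 // => l /andP[/andP[l1 lk] ne].
  by rewrite (_ : _ && _ = false) ?mulr0 //; lia.
rewrite big_nat big1 // => l /andP[l1 lk].
by rewrite (_ : _ && _ = false) ?mulr0 //; apply/negP; lia.
Qed.

(** The factors taken so far act only on the top left block of size [m]. Multiplying by the next one
    adds to each column a multiple of the preceding column, which is the recursion of [jac] read
    from the lower right corner. *)
Lemma prod_JJE (R : realType) (n : nat) (x : nat -> nat -> R) (m : nat) (i j : 'I_n) :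
  (m <= n)%N ->
  (\prod_(1 <= k < m) JJ n x k) i j =
    if (i < m)%N && (j < m)%N then jac x m (m.-1 - i) (m.-1 - j) else (i == j)%:R.
Proof.
elim: m i j => [|m IH] i j mn; first by rewrite big_geq ?mxE.
case: m IH mn => [|m] IH mn.
  rewrite big_geq // mxE /= -val_eqE /= !ltnS !leqn0.
  by case: ifP => // /andP[/eqP -> /eqP ->].
pose Q : 'M[R]_n := \prod_(1 <= k < m.+1) JJ n x k.
have {}IH a b : Q a b = if (a < m.+1)%N && (b < m.+1)%N
    then jac x m.+1 (m - a) (m - b) else (a == b)%:R by exact: IH (ltnW mn).
have -> : \prod_(1 <= k < m.+2) JJ n x k = Q *m JJ n x m.+1 by rewrite big_nat_recr.
rewrite mxE.
under eq_bigr => l _ do rewrite JJ_entry mulrDr.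
rewrite big_split.
have -> : \sum_l Q i l * (l == j)%:R = Q i j.
  rewrite (bigD1 j) // eqxx big1 => [|l ne]; first by rewrite /= mulr1 addr0.
  by rewrite (negbTE ne) mulr0.
have -> : \sum_l Q i l * (if (l.+1 == j)%N && (j <= m.+1)%N
      then x (m.+2 - j)%N m.+2 else 0) =
    if (0 < j <= m.+1)%N && (i < m.+1)%N
      then jac x m.+1 (m - i) (m.+1 - j) * x (m.+2 - j)%N m.+2 
      else if (0 < j <= m.+1)%N && (i.+1 == j) then x (m.+2 - j)%N m.+2 else 0.
  have [/andP[j0 jm]|nj] := boolP (0 < j <= m.+1)%N; last first.
    rewrite big1 // => l _; rewrite (_ : _ && _ = false) ?mulr0 //.
    by apply/negP; move: nj; lia.
  have j'n : (j.-1 < n)%N by exact: leq_ltn_trans (leq_pred _) (ltn_ord j).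
  rewrite (bigD1 (Ordinal j'n)) // prednK // eqxx jm big1 => [|l ne]; last first.
    rewrite (_ : _ && _ = false) ?mulr0 //; apply/negP => /andP[/eqP e _].
    by case/eqP: ne; apply: val_inj => /=; lia.
  rewrite /= addr0 IH -val_eqE /=.
  rewrite (_ : j.-1 < m.+1)%N ?andbT; last by lia.
  rewrite (_ : m - j.-1 = m.+1 - j)%N; last by lia.
  case: ifP => // _; case: (eqVneq i.+1 j) => e.
    by rewrite (_ : i == j.-1 :> nat) ?mul1r //; lia.
  by rewrite (_ : i == j.-1 :> nat = false) ?mul0r //; apply/negP; move: e; lia.
rewrite IH -val_eqE /=.
move: (nat_of_ord i) (nat_of_ord j) => a b.
have [am|ma] := ltnP a m.+1; last first.
  rewrite !andbF /= (_ : _ && (a.+1 == b) = false) ?addr0; last by apply/negP; lia.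
  case: ifP => // /andP[am bm].
  by rewrite (_ : m.+1 - a = 0)%N /=; last lia; congr (_%:R); lia.
rewrite (leqW am) /= andbT (@subSn a m am) /= [(b < m.+2)%N]ltnS.
have [bm|mb] := leqP b m.+1; last first.
  by rewrite (_ : (b < m.+1)%N = false) ?andbF ?addr0 //; lia.
rewrite andbT addrC; congr (_ + _); last first.
  have [bm'|mb] := ltnP b m.+1; first by rewrite subSn.
  by rewrite (_ : m.+1 - b = 0)%N ?ltn_eqF //; lia.
case: b bm => [|b] bm /=; last by rewrite (_ : m.+2 - b.+1 = (m.+1 - b.+1).+1)%N //; lia.
by rewrite jac_lower ?mul0r //; lia.
Qed.

Lemma jacobi_jac (R : realType) (n : nat) (M : 'M[R]_n) (x : nat -> nat -> R) :
  jacobi_coordinates M x -> forall i j, M i j = jac x n (rev_ord i) (rev_ord j).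
Proof.
move=> [_ ->] i j; rewrite prod_JJE // !ltn_ord /=.
by congr (jac _ _ _ _); have := ltn_ord i; have := ltn_ord j; lia.
Qed.

Lemma jac_jacobi (R : realType) (n : nat) (M : 'M[R]_n) (x : nat -> nat -> R) :
  (forall i j, 0 < x i j) ->
  (forall i j, M i j = jac x n (rev_ord i) (rev_ord j)) -> jacobi_coordinates M x.
Proof.
move=> x0 E; split => //; apply/matrixP => i j; rewrite E prod_JJE // !ltn_ord /=.
by congr (jac _ _ _ _); have := ltn_ord i; have := ltn_ord j; lia.
Qed.

(** * The factorization and its symmetries *)

Lemma NnP (R : realType) (n : nat) (M : 'M[R]_n) :
  Nn M <-> (forall i j : 'I_n, (j < i)%N -> M i j = 0) /\ forall i, M i i = 1.
Proof.
split=> [[[]]//|[M0 M1]]; split => //; split => //.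
rewrite unitmxE -det_tr det_trig; last by apply/is_trig_mxP => i j ij; rewrite mxE M0.
by rewrite big1 ?unitr1 // => i _; rewrite mxE M1.
Qed.

Lemma Nn_unit (R : realType) (n : nat) (M : 'M[R]_n) : Nn M -> M \in unitmx.
Proof. by case=> -[]. Qed.

Lemma Nn_det (R : realType) (n : nat) (M : 'M[R]_n) : Nn M -> \det M = 1.
Proof.
move=> /NnP[M0 M1]; rewrite -det_tr det_trig.
  by rewrite big1 // => i _; rewrite mxE M1.
by apply/is_trig_mxP => i j ij; rewrite mxE M0.
Qed.

Lemma Nn_mul (R : realType) (n : nat) (A B : 'M[R]_n) : Nn A -> Nn B -> Nn (A *m B).
Proof.
move=> /NnP[A0 A1] /NnP[B0 B1]; apply/NnP; split => [i j ji|i]; rewrite mxE.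
  rewrite big1 // => l _; have [li|il] := ltnP l i; first by rewrite A0 ?mul0r.
  by rewrite B0 ?mulr0 //; exact: leq_trans il.
rewrite (bigD1 i) //= A1 B1 mulr1 big1 ?addr0 // => l; rewrite -val_eqE /= => ne.
by have [li|il|] := ltngtP l i; [rewrite A0 ?mul0r|rewrite B0 ?mulr0|move=> e; rewrite e eqxx in ne].
Qed.

Lemma Nn_inv (R : realType) (n : nat) (A : 'M[R]_n) : Nn A -> Nn (invmx A).
Proof.
move=> NA; have := mulmxV (Nn_unit NA); move: (invmx A) => X AX.
have [A0 A1] := (NnP A).1 NA.
(* Back substitution, from the last row upwards. *)
have main p : forall i j : 'I_n, (n - i <= p)%N -> (j <= i)%N -> X i j = (i == j)%:R.
  elim: p => [|p IH] i j; first by have := ltn_ord i; lia.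
  move=> ip ji; have := congr1 (fun m : 'M[R]_n => m i j) AX.
  rewrite !mxE (bigD1 i) //= A1 mul1r big1 ?addr0 // => l; rewrite -val_eqE /= => ne.
  have [li|il] := ltnP l i; first by rewrite A0 ?mul0r.
  rewrite IH; [|lia|lia].
  by rewrite (_ : l == j = false) ?mulr0 // -val_eqE /=; lia.
apply/NnP; split => [i j ji|i].
  by rewrite (main n i j (leq_subr _ _) (ltnW ji)) -val_eqE /= gtn_eqF.
by rewrite (main n i i (leq_subr _ _) (leqnn _)) eqxx.
Qed.

Definition diag_inv (R : realType) (n : nat) (d : 'rV[R]_n) : 'rV[R]_n :=
  \row_i (d 0 i)^-1.

Lemma diag_mx_inv (R : realType) (n : nat) (d : 'rV[R]_n) : (forall i, d 0 i != 0) ->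
  diag_mx d *m diag_mx (diag_inv d) = 1%:M.
Proof.
move=> d0; apply/matrixP => i j; rewrite mul_diag_mx !mxE.
by case: eqP => _; rewrite ?mulr1n ?divff // !mulr0n mulr0.
Qed.

Lemma diag_mx_invV (R : realType) (n : nat) (d : 'rV[R]_n) : (forall i, d 0 i != 0) ->
  diag_mx (diag_inv d) *m diag_mx d = 1%:M.
Proof. by move=> d0; apply: mulmx1C; exact: diag_mx_inv. Qed.

Lemma Nn_conj (R : realType) (n : nat) (d : 'rV[R]_n) (A : 'M[R]_n) :
  (forall i, d 0 i != 0) -> Nn A ->
  Nn (diag_mx d *m A *m diag_mx (diag_inv d)).
Proof.
move=> d0 /NnP[A0 A1]; apply/NnP; split => [i j ji|i]; rewrite mul_mx_diag mul_diag_mx !mxE.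
  by rewrite A0 // mulr0 mul0r.
by rewrite A1 mulr1 divff.
Qed.

(* [A], [B] and [diag_mx d] are M', M'' and D_M, without positivity. *)
Definition bigcell (R : realType) (n : nat) (M A B : 'M[R]_n) (d : 'rV[R]_n) : Prop :=
  [/\ Nn M, Nn A, Nn B &
      M *m Pmx R n = Pmx R n *m A *m Pmx R n *m diag_mx d *m B].

Lemma mulmx_PmxK (R : realType) (m n : nat) (X : 'M[R]_(m, n)) :
  X *m Pmx R n *m Pmx R n = X.
Proof. by rewrite -mulmxA PmxK mulmx1. Qed.

Lemma bigcell_neq0 (R : realType) (n : nat) (M A B : 'M[R]_n) (d : 'rV[R]_n) :
  bigcell M A B d -> forall i, d 0 i != 0.
Proof.
move=> [NM NA NB E] i; have := congr1 determinant E.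
rewrite !det_mulmx (Nn_det NM) (Nn_det NA) (Nn_det NB) mul1r !mulr1 det_Pmx_sqr mul1r det_diag => e.
apply/eqP => di; have := det_Pmx_sqr R n.
by rewrite e (bigD1 i) //= di !mul0r => /eqP; rewrite eq_sym oner_eq0.
Qed.

(** [P X P D = D' Y] equates a lower and an upper triangular matrix, so both are diagonal; the unit
    diagonals of [X] and [Y] then give [D = D'] and [X = Y = 1]. *)
Lemma bigcell_uniq (R : realType) (n : nat) (M A B A' B' : 'M[R]_n) (d d' : 'rV[R]_n) :
  bigcell M A B d -> bigcell M A' B' d' -> [/\ A = A', B = B' & d = d'].
Proof.
move=> h h'; have d0 := bigcell_neq0 h; have d'0 := bigcell_neq0 h'.
case: h h' => NM NA NB E [_ NA' NB' E'].
pose X := invmx A' *m A; pose Y := B' *m invmx B.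
have [X0 X1] := (NnP X).1 (Nn_mul (Nn_inv NA') NA).
have [Y0 Y1] := (NnP Y).1 (Nn_mul NB' (Nn_inv NB)).
have XY : Pmx R n *m X *m Pmx R n *m diag_mx d = diag_mx d' *m Y.
  rewrite /X /Y -[LHS](mulmxK (Nn_unit NB)) mulmxA; congr (_ *m _).
  transitivity (Pmx R n *m invmx A' *m Pmx R n *m
      (Pmx R n *m A *m Pmx R n *m diag_mx d *m B)); first by rewrite !mulmxA mulmx_PmxK.
  rewrite -E E' !mulmxA mulmx_PmxK -(mulmxA (Pmx R n)) mulVmx ?Nn_unit // mulmx1.
  by rewrite PmxK mul1mx.
have XYij i j : X (rev_ord i) (rev_ord j) * d 0 j = d' 0 i * Y i j.
  have := congr1 (fun m : 'M[R]_n => m i j) XY.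
  by rewrite mul_mx_diag mul_diag_mx mxE [RHS]mxE mulmx_Pmx mul_Pmx.
have dd' : d = d'.
  by apply/rowP => i; have := XYij i i; rewrite X1 Y1 mul1r mulr1.
have YI : Y = 1%:M.
  apply/matrixP => i j; rewrite [RHS]mxE -val_eqE /=; case: (ltngtP i j) => [ij|ji|/val_inj->].
  - have := XYij i j; rewrite X0 ?mul0r /=; last by have := ltn_ord j; lia.
    by move/esym/eqP; rewrite mulf_eq0 (negbTE (d'0 i)) => /eqP.
  - exact: Y0.
  - exact: Y1.
have XI : X = 1%:M.
  apply/matrixP => i j; have := XYij (rev_ord i) (rev_ord j).
  rewrite !rev_ordK YI dd' [1%:M i j]mxE [1%:M _ _]mxE (inj_eq rev_ord_inj) mulrC; case: eqP => [->|_].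
    by apply: mulfI.
  by rewrite mulr0 => /eqP; rewrite mulf_eq0 (negbTE (d'0 _)) => /eqP.
split => //.
  by rewrite -[A](mulKVmx (Nn_unit NA')) -/X XI mulmx1.
by rewrite -[B'](mulmxKV (Nn_unit NB)) -/Y YI mul1mx.
Qed.

(** The factorization of [M] solved for [A], with [D^-1] moved to the left of the last factor. *)
Lemma bigcell_prime (R : realType) (n : nat) (M A B : 'M[R]_n) (d : 'rV[R]_n) :
  bigcell M A B d ->
  bigcell A M (diag_mx d *m invmx B *m diag_mx (diag_inv d)) (diag_inv d).
Proof.
move=> h; have d0 := bigcell_neq0 h; case: h => NM NA NB E.
split => //; first by apply: Nn_conj => //; exact: Nn_inv.
rewrite -(mulmxA _ M) E !mulmxA PmxK mul1mx.
have dK (X : 'M[R]_n) : X *m diag_mx d *m diag_mx (diag_inv d) = X.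
  by rewrite -mulmxA diag_mx_inv ?mulmx1.
have dKV (X : 'M[R]_n) : X *m diag_mx (diag_inv d) *m diag_mx d = X.
  by rewrite -mulmxA diag_mx_invV ?mulmx1.
by rewrite dKV mulmxK ?Nn_unit // dK.
Qed.

Definition diag_rev (R : realType) (n : nat) (d : 'rV[R]_n) : 'rV[R]_n :=
  \row_i d 0 (rev_ord i).

Lemma diag_mx_rev (R : realType) (n : nat) (d : 'rV[R]_n) :
  diag_mx (diag_rev d) = Pmx R n *m diag_mx d *m Pmx R n.
Proof.
apply/matrixP => i j; rewrite mulmx_Pmx mul_Pmx !mxE (inj_eq rev_ord_inj).
by case: eqP => [->|_].
Qed.

(** The factorization of [M] solved for [B]; carrying the diagonal factor across [P] reverses its
    entries. *)
Lemma bigcell_dprime (R : realType) (n : nat) (M A B : 'M[R]_n) (d : 'rV[R]_n) :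
  bigcell M A B d ->
  bigcell B (diag_mx (diag_inv (diag_rev d)) *m invmx A *m diag_mx (diag_rev d))
    M (diag_inv d).
Proof.
move=> h; have d0 := bigcell_neq0 h; case: h => NM NA NB E.
have invK (c : 'rV[R]_n) : diag_inv (diag_inv c) = c.
  by apply/rowP => i; rewrite !mxE invrK.
have r0 i : diag_inv (diag_rev d) 0 i != 0 by rewrite !mxE invr_eq0.
split => //.
  by rewrite -{2}[diag_rev d]invK; apply: Nn_conj => //; exact: Nn_inv.
have -> : diag_inv (diag_rev d) = diag_rev (diag_inv d) by apply/rowP => i; rewrite !mxE.
rewrite !diag_mx_rev !mulmxA PmxK mul1mx mulmx_PmxK -(mulmxA _ (diag_mx d)) diag_mx_inv // mulmx1.
have -> : M = Pmx R n *m A *m Pmx R n *m diag_mx d *m B *m Pmx R n by rewrite -E mulmx_PmxK.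
rewrite !mulmxA mulmx_PmxK -(mulmxA _ (invmx A)) mulVmx ?Nn_unit // mulmx1 mulmx_PmxK.
by rewrite diag_mx_invV // mul1mx.
Qed.

(** Reflection in the antidiagonal. It reverses products and so exchanges the two factors of
    [bigcell], which carries positivity from the first factor to the second. *)
Definition antitr (R : realType) (n : nat) (M : 'M[R]_n) : 'M[R]_n :=
  Pmx R n *m M^T *m Pmx R n.

Lemma antitrE (R : realType) (n : nat) (M : 'M[R]_n) i j :
  antitr M i j = M (rev_ord j) (rev_ord i).
Proof. by rewrite /antitr mulmx_Pmx mul_Pmx mxE. Qed.

Lemma antitrK (R : realType) (n : nat) (M : 'M[R]_n) : antitr (antitr M) = M.
Proof. by apply/matrixP => i j; rewrite !antitrE !rev_ordK. Qed.

Lemma Nn_antitr (R : realType) (n : nat) (M : 'M[R]_n) : Nn M -> Nn (antitr M).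
Proof.
move=> /NnP[M0 M1]; apply/NnP; split => [i j ji|i]; rewrite antitrE //.
by apply: M0 => /=; have := ltn_ord i; lia.
Qed.

Lemma bigcell_antitr (R : realType) (n : nat) (M A B : 'M[R]_n) (d : 'rV[R]_n) :
  bigcell M A B d -> bigcell (antitr M) (antitr B) (antitr A) d.
Proof.
move=> [NM NA NB E]; split; rewrite ?Nn_antitr //; try exact: Nn_antitr.
have PT : (Pmx R n)^T = Pmx R n by apply/matrixP => a b; rewrite !mxE addnC.
have : (M *m Pmx R n)^T = (Pmx R n *m A *m Pmx R n *m diag_mx d *m B)^T by rewrite E.
rewrite !trmx_mul PT tr_diag_mx => E'.
by rewrite /antitr mulmx_PmxK E' !mulmxA mulmx_PmxK PmxK mul1mx.
Qed.

(** * Positivity of the factors *)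

(** Padding with the identity preserves triangularity and unit diagonals, so that the results on
    arrays indexed by [nat] apply to matrices. *)
Definition extmx (R : comNzRingType) (n : nat) (M : 'M[R]_n) (i j : nat) : R :=
  match insub i : option 'I_n, insub j : option 'I_n with
  | Some a, Some b => M a b
  | _, _ => (i == j)%:R
  end.

Lemma extmxE (R : comNzRingType) (n : nat) (M : 'M[R]_n) (i j : 'I_n) :
  extmx M i j = M i j.
Proof. by rewrite /extmx !valK. Qed.

Lemma extmx_lower (R : comNzRingType) (n : nat) (M : 'M[R]_n) :
  (forall i j : 'I_n, (i < j)%N -> M i j = 0) -> lower (extmx M).
Proof.
move=> M0 i j ij; rewrite /extmx.
case: (insubP _ i) => [a _ ai|_]; last by rewrite ltn_eqF.
case: (insubP _ j) => [b _ bj|_]; last by rewrite ltn_eqF.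
by apply: M0; rewrite /= in ai bj; rewrite ai bj.
Qed.

Lemma extmx_diag (R : comNzRingType) (n : nat) (M : 'M[R]_n) :
  (forall i, M i i = 1) -> forall i, extmx M i i = 1.
Proof. by move=> M1 i; rewrite /extmx; case: (insub i); rewrite ?eqxx. Qed.

Lemma upper_minor_le (R : realType) (n k : nat) (f g : 'I_k -> 'I_n) (H : 'M[R]_n) :
  {homo f : i j / (i < j)%N} -> {homo g : i j / (i < j)%N} ->
  Bn H -> \det (mxsub f g H) != 0 -> forall i, (f i <= g i)%N.
Proof.
move=> fi gi [H0 _] + m; apply: contra_neqT; rewrite -ltnNge => gf.
rewrite -det_tr -[RHS](minor_lower0 (f := g) (g := f) (extmx_lower (M := H^T) _) gi fi gf).
  by congr (\det _); apply/matrixP => i j; rewrite !mxE extmxE mxE.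
by move=> i j ij; rewrite mxE H0.
Qed.

Definition jac_mx (R : realType) (n : nat) (x : nat -> nat -> R) : 'M[R]_n :=
  \matrix_(i, j) jac x n (rev_ord i) (rev_ord j).

Lemma Nn_jac (R : realType) (n : nat) (x : nat -> nat -> R) : Nn (jac_mx n x).
Proof.
apply/NnP; split => [i j ji|i]; rewrite mxE ?jac_diag //.
by rewrite jac_lower //=; have := ltn_ord i; lia.
Qed.

Lemma minor_jac_mx_gt0 (R : realType) (n k : nat) (x : nat -> nat -> R) (f g : 'I_k -> 'I_n) :
  (forall i j, 0 < x i j) ->
  {homo f : i j / (i < j)%N} -> {homo g : i j / (i < j)%N} ->
  (forall i, (f i <= g i)%N) -> 0 < \det (mxsub f g (jac_mx n x)).
Proof.
move=> x0 fi gi fg.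
pose f' i : nat := rev_ord (f (rev_ord i)); pose g' i : nat := rev_ord (g (rev_ord i)).
have incr_rev (h : 'I_k -> 'I_n) : {homo h : i j / (i < j)%N} ->
    incr (fun i : 'I_k => rev_ord (h (rev_ord i)) : nat).
  move=> hi i j ij /=; have /hi : (rev_ord j < rev_ord i)%N.
    by rewrite /=; have := ltn_ord j; lia.
  by have := ltn_ord (h (rev_ord i)); lia.
have /= := @minor_jac_gt0 R x n k f' g' x0 (incr_rev f fi) (incr_rev g gi).
have -> : minor (jac x n) f' g' = \det (mxsub f g (jac_mx n x)).
  rewrite /minor -[LHS]det_rev; congr (\det _); apply/matrixP => i j.
  by rewrite !mxE /f' /g' !rev_ordK.
apply => i; rewrite /f' /g' ?ltn_ord //=.
by have := fg (rev_ord i); lia.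
Qed.

Lemma Nn_pos_jac (R : realType) (n : nat) (x : nat -> nat -> R) :
  (forall i j, 0 < x i j) -> Nn_pos (jac_mx n x).
Proof.
move=> x0; have N := Nn_jac n x; split => //; split => [|k f g fi gi [H [BH H0]]].
  by case: N.
by apply: minor_jac_mx_gt0 => //; exact: upper_minor_le H0.
Qed.

(** The minors that do not vanish identically on [Bn] are those with [f <= g] pointwise:
    [upper_minor_le] gives one direction, the Jacobi product with all coordinates 1 the other. *)
Lemma Nn_posP (R : realType) (n : nat) (M : 'M[R]_n) :
  Nn_pos M <-> Nn M /\ forall k (f g : 'I_k -> 'I_n),
    {homo f : i j / (i < j)%N} -> {homo g : i j / (i < j)%N} ->
    (forall i, (f i <= g i)%N) -> 0 < \det (mxsub f g M).
Proof.
split=> [[NM [_ Mpos]]|[NM Mpos]]; split => //.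
  move=> k f g fi gi fg; apply: Mpos => //; exists (jac_mx n (fun _ _ => 1)).
  split; first by case: (Nn_jac n (fun _ _ => 1 : R)).
  by apply/lt0r_neq0/minor_jac_mx_gt0 => // *; exact: ltr01.
split; first by case: NM.
by move=> k f g fi gi [H [BH H0]]; apply: Mpos => //; exact: upper_minor_le H0.
Qed.

Lemma Nn_pos_antitr (R : realType) (n : nat) (M : 'M[R]_n) : Nn_pos M -> Nn_pos (antitr M).
Proof.
move=> /Nn_posP[NM Mpos]; apply/Nn_posP; split => [|k f g fi gi fg]; first exact: Nn_antitr.
have revi (h : 'I_k -> 'I_n) : {homo h : i j / (i < j)%N} ->
    {homo (fun i => rev_ord (h (rev_ord i))) : i j / (i < j)%N}.
  move=> hi i j ij /=; have /hi : (rev_ord j < rev_ord i)%N.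
    by rewrite /=; have := ltn_ord j; lia.
  by have := ltn_ord (h (rev_ord i)); lia.
have -> : \det (mxsub f g (antitr M)) = \det (mxsub (fun i => rev_ord (g (rev_ord i)))
    (fun i => rev_ord (f (rev_ord i))) M).
  rewrite -[RHS]det_tr -[RHS]det_rev; congr (\det _); apply/matrixP => i j.
  by rewrite mxE antitrE !mxE !rev_ordK.
apply: Mpos => [||i] /=; [exact: revi|exact: revi|].
by have := fg (rev_ord i); lia.
Qed.

(** Each index must leave room for the larger ones after it; this compares any [k] rows with the
    last [k] columns. *)
Lemma incr_bound (n k : nat) (f : 'I_k -> nat) : incr f -> (forall i, f i < n)%N ->
  forall i : 'I_k, (f i + k <= n + i)%N.
Proof.
move=> fi fn.
have main p : forall i : 'I_k, (i + p < k)%N -> (f i + p < n)%N.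
  elim: p => [|p IH] i ip; first by rewrite addn0.
  have ik : (i.+1 < k)%N by lia.
  by have := IH (Ordinal ik); have := fi i (Ordinal ik); rewrite /=; lia.
by move=> i; have := main (k - i.+1)%N i; have := ltn_ord i; lia.
Qed.

Lemma bigcell_exists (R : realType) (n : nat) (M : 'M[R]_n) : Nn_pos M ->
  exists A B d, [/\ bigcell M A B d, Nn_pos A &
    exists2 x, (forall i j, 0 < x i j) & A = jac_mx n x].
Proof.
move=> /Nn_posP[NM Mpos].
pose S := extmx (M *m Pmx R n).
(* The first [k] columns of [M P] are the last [k] columns of [M] in reversed order, whence the sign
   [\det (Pmx R k)]. *)
have Spos k (f : 'I_k -> nat) : (k <= n)%N -> incr f -> (forall i, f i < n)%N ->
    0 < minor S f (@nat_of_ord k) * \det (Pmx R k).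
  move=> kn fi fn.
  have gP (j : 'I_k) : (n - k + j < n)%N by have := ltn_ord j; lia.
  rewrite -det_rev_cols.
  have -> : \matrix_(i, j) (\matrix_(i0, j0) S (f i0) j0) i (rev_ord j) =
      mxsub (fun i => Ordinal (fn i)) (fun j => Ordinal (gP j)) M.
    apply/matrixP => i j; rewrite !mxE.
    have jn : (rev_ord j < n)%N by exact: leq_trans kn.
    rewrite -[f i]/(nat_of_ord (Ordinal (fn i))) -[X in S _ X]/(nat_of_ord (Ordinal jn)).
    rewrite /S extmxE mulmx_Pmx; congr (M _ _); apply: val_inj => /=.
    by have := ltn_ord j; lia.
  apply: Mpos => [i j ij|i j ij|i] /=; [exact: fi|lia|].
  by have := incr_bound fi fn i; lia.
have idi k : incr (@nat_of_ord k) by [].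
have [|L [d [U [Ll L1 Ul U1 E]]]] := @ldu_exists _ S n.
  move=> k kn; have kl (i : 'I_k) : (i < n)%N by exact: leq_trans kn.
  by have := Spos k _ kn (@idi k) kl; apply: contraTneq => e; rewrite /minor e mul0r ltxx.
have prodE k (f : 'I_k -> nat) : (k <= n)%N -> (forall i, f i < n)%N ->
    minor S f (@nat_of_ord k) = minor L f (@nat_of_ord k) * \prod_(l < k) d l.
  by move=> kn fn; apply: minor_ldu E _ _.
have prod0 k : (k <= n)%N -> 0 < (\prod_(l < k) d l) * \det (Pmx R k).
  move=> kn; have kl (i : 'I_k) : (i < n)%N by exact: leq_trans kn.
  have := Spos k _ kn (@idi k) kl; rewrite prodE // [minor L _ _]det_trig.
    by rewrite big1 ?mul1r // => i _; rewrite mxE.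
  by apply/is_trig_mxP => i j ij; rewrite mxE Ll.
(* A minor of [L] on initial columns is a minor of [S] divided by a product of pivots; both carry
   the sign [\det (Pmx R k)], which cancels. *)
have [|x x0 Lx] := jac_exists (n := n) Ll L1.
  move=> k f kn fi fn; have := Spos k f kn fi fn.
  by rewrite prodE // -mulrA pmulr_lgt0 // prod0.
exists (jac_mx n x), (\matrix_(i, j) U i j), (\row_i d i); split.
- split => //; first exact: Nn_jac.
    by apply/NnP; split => [i j ji|i]; rewrite mxE ?U1 ?Ul.
  apply/matrixP => i j; rewrite -extmxE -/S E // mxE; apply: eq_bigr => l _.
  by rewrite mul_mx_diag mxE mulmx_Pmx mul_Pmx !mxE !rev_ordK Lx.
- exact: Nn_pos_jac.
- by exists x.
Qed.

(** [M] is the first factor of its own first factor, and first factors are constructed with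
    coordinates. *)
Lemma Nn_pos_coordinates (R : realType) (n : nat) (M : 'M[R]_n) : Nn_pos M ->
  exists x, jacobi_coordinates M x.
Proof.
move=> /bigcell_exists[A [B [d [/bigcell_prime h Apos _]]]].
have [A' [B' [d' [h' _ [x x0 A'x]]]]] := bigcell_exists Apos.
have [-> _ _] := bigcell_uniq h h'; exists x; apply: jac_jacobi => // i j.
by rewrite A'x mxE.
Qed.

Lemma bigcell_pos (R : realType) (n : nat) (M A B : 'M[R]_n) (d : 'rV[R]_n) :
  Nn_pos M -> bigcell M A B d -> Nn_pos A /\ Nn_pos B.
Proof.
move=> Mpos h; split.
  by have [A' [B' [d' [h' A'pos _]]]] := bigcell_exists Mpos; have [-> _ _] := bigcell_uniq h h'.
have [A' [B' [d' [h' A'pos _]]]] := bigcell_exists (Nn_pos_antitr Mpos).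
have [e _ _] := bigcell_uniq (bigcell_antitr h) h'.
by rewrite -[B]antitrK e; exact: Nn_pos_antitr.
Qed.

Lemma prime_factorsP (R : realType) (n : nat) (M A B : 'M[R]_n) : Nn_pos M ->
  prime_factors M A B <-> exists d, bigcell M A B d.
Proof.
move=> Mpos; split => [[[NA _] [NB _] [D [/is_diag_mxP Dd E]]]|[d h]].
  have DE : D = diag_mx (\row_i D i i).
    apply/matrixP => i j; rewrite !mxE; case: eqP => [->|ne]; first by rewrite mulr1n.
    by rewrite mulr0n Dd //; apply: contra_not_neq ne => /val_inj.
  exists (\row_i D i i); split => //; first by case: Mpos.
  transitivity (Pmx R n *m (Pmx R n *m M *m Pmx R n)).
    by rewrite !mulmxA PmxK mul1mx.
  by rewrite E -DE !mulmxA.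
have [Apos Bpos] := bigcell_pos Mpos h; split => //; exists (diag_mx d).
split; first exact: diag_mx_is_diag.
by case: h => _ _ _ E; rewrite -mulmxA E !mulmxA PmxK mul1mx.
Qed.

Lemma mx_prime_bigcell (R : realType) (n : nat) (M A B : 'M[R]_n) (d : 'rV[R]_n) :
  Nn_pos M -> bigcell M A B d -> mx_prime M = A.
Proof.
move=> Mpos h; apply: xget_unique => [|A' [B' /(prime_factorsP _ _ Mpos)[d' h']]].
  by exists B; apply/prime_factorsP => //; exists d.
by have [] := bigcell_uniq h' h.
Qed.

Lemma mx_dprime_bigcell (R : realType) (n : nat) (M A B : 'M[R]_n) (d : 'rV[R]_n) :
  Nn_pos M -> bigcell M A B d -> mx_dprime M = B.
Proof.
move=> Mpos h; apply: xget_unique => [|B' [A' /(prime_factorsP _ _ Mpos)[d' h']]].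
  by exists A; apply/prime_factorsP => //; exists d.
by have [] := bigcell_uniq h' h.
Qed.

(** * The diagonal factor *)

(** The leading minors of [M P] are both the corner monomials and the partial products of [d];
    consecutive quotients isolate the entries of [d]. *)
Lemma bigcell_diagE (R : realType) (n : nat) (M A B : 'M[R]_n) (d : 'rV[R]_n) x :
  bigcell M A B d -> jacobi_coordinates M x ->
  forall i, d 0 i = (-1) ^+ i * hook n x i.+1.
Proof.
move=> [NM NA NB E] Mx i; have [x0 _] := Mx.
pose d' l : R := if insub l is Some a then d 0 a else 0.
have d'E (l : 'I_n) : d' l = d 0 l by rewrite /d' valK.
pose L : 'M[R]_n := Pmx R n *m A *m Pmx R n.
have [A0 A1] := (NnP A).1 NA; have [B0 B1] := (NnP B).1 NB.
have LE a b : L a b = A (rev_ord a) (rev_ord b) by rewrite mulmx_Pmx mul_Pmx.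
have Ll : lower (extmx L).
  apply: extmx_lower => a b ab; rewrite LE A0 //=.
  by have := ltn_ord b; lia.
have Ul : lower (fun a b => extmx B b a).
  move=> a b ab; have -> : extmx B b a = extmx B^T a b.
    by rewrite /extmx; case: (insub a) => [?|]; case: (insub b) => [?|]; rewrite ?mxE // eq_sym.
  by rewrite extmx_lower // => *; rewrite mxE B0.
have cornerP k : (k <= n)%N -> corner x n k = \prod_(l < k) d' l.
  move=> kn; rewrite /corner.
  have -> : minor (jac x n) (fun a : 'I_k => n.-1 - a)%N (@nat_of_ord k) =
      minor (fun a b => jac x n (n.-1 - a) b) (@nat_of_ord k) (@nat_of_ord k) by [].
  rewrite (@minor_ldu R _ (extmx L) (extmx B) d' n) // => [|||a] //.
  - rewrite [minor _ _ _]det_trig; last by apply/is_trig_mxP => a b ab; rewrite mxE Ll.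
    rewrite big1 ?mul1r // => a _; rewrite mxE extmx_diag // => b.
    by rewrite LE A1.
  - exact: extmx_diag.
  - move=> a b an bn; rewrite -[a]/(nat_of_ord (Ordinal an)) -[b]/(nat_of_ord (Ordinal bn)).
    have := congr1 (fun m : 'M[R]_n => m (Ordinal an) (Ordinal bn)) E.
    rewrite mulmx_Pmx (jacobi_jac Mx) rev_ordK /= => e.
    have -> : (n.-1 - a = n - a.+1)%N by lia.
    rewrite e -/L mxE; apply: eq_bigr => l _.
    by rewrite mul_mx_diag mxE d'E -!extmxE.
  - exact: leq_trans kn.
have := cornerP _ (ltn_ord i); rewrite corner_ratio // big_ord_recr /= -cornerP ?(ltnW (ltn_ord i)) //.
by move/(mulfI (corner_neq0 x0 (ltnW (ltn_ord i)))) => ->; rewrite d'E.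
Qed.

(** * The coordinate condition as a balance condition on the diagonal factor *)

Lemma hook_gt0 (R : realType) (n : nat) (x : nat -> nat -> R) (i : nat) :
  (forall i j, (1 <= i)%N -> (i < j)%N -> (j <= n)%N -> 0 < x i j) ->
  (1 <= i <= n)%N -> 0 < hook n x i.
Proof.
move=> x0 /andP[i1 ilen]; apply: divr_gt0; rewrite big_nat; apply: prodr_gt0 => k /andP[k1 k2].
  by apply: x0.
by apply: x0.
Qed.

Lemma prod_nat_reflect (R : comNzRingType) (N a b : nat) (F : nat -> R) :
  (b <= N.+1)%N ->
  \prod_(a <= k < b) F k = \prod_(N.+1 - b <= k < N.+1 - a) F (N - k)%N.
Proof.
move=> bN; rewrite -[a in LHS]add0n big_addn -[(N.+1 - b)%N]add0n big_addn [RHS]big_nat_rev.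
have -> : (N.+1 - a - (N.+1 - b) = b - a)%N by lia.
by apply: eq_big_nat => k /andP[_ kb]; congr (F _); lia.
Qed.

Lemma eq_ratio_prod1 (F : fieldType) (a b e f : F) :
  b != 0 -> e != 0 -> f != 0 -> a / b = e / f <-> a / e * (f / b) = 1.
Proof.
move=> b0 e0 f0; have -> : a / e * (f / b) = a / b / (e / f) by field; rewrite b0 e0 f0.
by split=> [->|/divr1_eq//]; rewrite divff // mulf_neq0 ?invr_eq0.
Qed.

(** Reflecting [k] to [n + 1 - k] turns the two products of denominators into the column and the row
    that make up the hook at [n + 1 - i]. *)
Lemma hook_balance (R : realType) (n : nat) (x : nat -> nat -> R) (i : nat) :
  (forall i j, (1 <= i)%N -> (i < j)%N -> (j <= n)%N -> 0 < x i j) ->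
  (1 <= i <= n)%N ->
  (\prod_(i.+1 <= k < n.+1) (x i k / x (n.+1 - k)%N (n.+1 - i)%N) =
   \prod_(1 <= k < i) (x k i / x (n.+1 - i)%N (n.+1 - k)%N)) <->
  hook n x i * hook n x (n.+1 - i) = 1.
Proof.
move=> x0 /andP[i1 ilen]; rewrite /hook.
rewrite (@prod_nat_reflect _ n.+1 (n.+1 - i).+1 n.+1) //.
rewrite (@prod_nat_reflect _ n.+1 1 (n.+1 - i)); last by lia.
have -> : (n.+2 - n.+1 = 1)%N by lia.
have -> : (n.+2 - (n.+1 - i).+1 = i)%N by lia.
have -> : (n.+2 - (n.+1 - i) = i.+1)%N by lia.
have -> : (n.+2 - 1 = n.+1)%N by lia.
rewrite !big_split /= !prodfV.
have p2 : \prod_(i.+1 <= k < n.+1) x (n.+1 - k)%N (n.+1 - i)%N != 0.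
  rewrite big_nat; apply/lt0r_neq0/prodr_gt0 => k /andP[k1 k2]; apply: x0 => //; lia.
have p3 : \prod_(1 <= k < i) x k i != 0.
  rewrite big_nat; apply/lt0r_neq0/prodr_gt0 => k /andP[k1 k2]; apply: x0 => //; lia.
have p4 : \prod_(1 <= k < i) x (n.+1 - i)%N (n.+1 - k)%N != 0.
  rewrite big_nat; apply/lt0r_neq0/prodr_gt0 => k /andP[k1 k2]; apply: x0 => //; lia.
exact: eq_ratio_prod1.
Qed.

(** Equivalently, [D (P D P)] is the scalar matrix [(-1)^(n-1)]. *)
Definition balanced (R : realType) (n : nat) (d : 'rV[R]_n) : Prop :=
  forall i, d 0 i * d 0 (rev_ord i) = (-1) ^+ n.-1.

Lemma bigcell_prod (R : realType) (n : nat) (M A B : 'M[R]_n) (d : 'rV[R]_n) :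
  bigcell M A B d -> \prod_i d 0 i = \det (Pmx R n).
Proof.
move=> [NM NA NB E]; have := congr1 determinant E.
rewrite !det_mulmx (Nn_det NM) (Nn_det NA) (Nn_det NB) mul1r !mulr1 det_Pmx_sqr mul1r.
by rewrite det_diag.
Qed.

Lemma sign_rev (R : realType) (n : nat) (i : 'I_n) :
  (-1) ^+ i * (-1) ^+ rev_ord i = (-1) ^+ n.-1 :> R.
Proof. by rewrite -exprD; congr (_ ^+ _) => /=; have := ltn_ord i; lia. Qed.

(* The condition defining [Nn_tilde] omits the middle indices; they are
   recovered from \prod_i d_i^2 = 1. *)
Lemma balancedP (R : realType) (n : nat) (M A B : 'M[R]_n) (d : 'rV[R]_n) x :
  bigcell M A B d -> jacobi_coordinates M x ->
  (forall i : nat, (1 <= i)%N -> (i.*2 < n)%N ->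
    \prod_(i.+1 <= k < n.+1) (x i k / x (n.+1 - k)%N (n.+1 - i)%N) =
    \prod_(1 <= k < i) (x k i / x (n.+1 - i)%N (n.+1 - k)%N)) <->
  balanced d.
Proof.
move=> h Mx; have [x0 _] := Mx; have dE := bigcell_diagE h Mx.
pose c i := hook n x i * hook n x (n.+1 - i).
have cE (i : 'I_n) : d 0 i * d 0 (rev_ord i) = (-1) ^+ n.-1 * c i.+1.
  rewrite !dE -(sign_rev R i) mulrACA; congr (_ * (_ * hook _ _ _)).
  by rewrite /=; have := ltn_ord i; lia.
have cond i : (1 <= i <= n)%N -> _ <-> c i = 1 := fun hi => hook_balance x0 hi.
have crev i : (i <= n.+1)%N -> c (n.+1 - i)%N = c i by move=> hi; rewrite /c subKn // mulrC.
split=> [hc|db i i1 i2]; last first.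
  apply/cond; first by lia.
  have in' : (i.-1 < n)%N by lia.
  have := cE (Ordinal in'); rewrite db /= prednK // => e.
  by apply: (mulfI (_ : (-1) ^+ n.-1 != 0 :> R)); rewrite ?signr_eq0 // -e mulr1.
have {}hc i : (1 <= i)%N -> (i.*2 < n)%N -> c i = 1.
  by move=> i1 i2; apply/cond; [lia|exact: hc].
(* Indices in the upper half reduce to the lower half by reflection; the excluded values of [i.*2]
   are the central ones. *)
have c1 i : (1 <= i <= n)%N -> (i.*2 != n) -> (i.*2 != n.+1) -> (i.*2 != n.+2) -> c i = 1.
  move=> /andP[i1 ilen] e1 e2 e3; have [lt|ge] := ltnP i.*2 n; first exact: hc.
  by rewrite -crev ?hc //; lia.
have c0 i : (1 <= i <= n)%N -> 0 < c i.
  by move=> hi; apply: mulr_gt0; apply: hook_gt0 => //; lia.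
(* Each entry of [d] occurs twice, giving the square of [\det P]; norms remove the signs, as all [c]
   are positive. *)
have prodc : \prod_(i < n) c i.+1 = 1.
  have : \prod_(i < n) (d 0 i * d 0 (rev_ord i)) = 1.
    rewrite big_split /= [X in _ * X](reindex_inj rev_ord_inj) /=.
    under [X in _ * X]eq_bigr => i _ do rewrite rev_ordK.
    by rewrite (bigcell_prod h) det_Pmx_sqr.
  under eq_bigr => i _ do rewrite cE.
  rewrite big_split /= => /(congr1 Num.norm); rewrite normrM normr1.
  rewrite normr_prod big1 ?mul1r => [|i _]; last by rewrite normrX normrN1 expr1n.
  by rewrite ger0_norm // prodr_ge0 // => i _; apply/ltW/c0; have := ltn_ord i; lia.
move=> i; rewrite cE; suff -> : c i.+1 = 1 by rewrite mulr1.
(* For a central index, all other factors of [prodc] are 1 except that of its mirror image. A fixed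
   point gives [c = 1] at once; a central pair gives [c ^ 2 = 1] with [c] positive. *)
have [e|ne] := eqVneq i (rev_ord i).
  move: prodc; rewrite (bigD1 i) //= big1 ?mulr1 // => j; rewrite -val_eqE /= => ne.
  by move/(congr1 val): e => /= e; apply: c1; have := ltn_ord j; lia.
have cri : c (rev_ord i).+1 = c i.+1.
  have -> : (rev_ord i).+1 = (n.+1 - i.+1)%N by rewrite /=; have := ltn_ord i; lia.
  by rewrite crev // leqW.
move: prodc; rewrite (bigD1 i) //= (bigD1 (rev_ord i)) /=; last by rewrite eq_sym.
rewrite cri; have [mid|nmid] := boolP ((i.+1).*2 \in [:: n; n.+1; n.+2]); last first.
  by move=> _; move: nmid; rewrite !inE !negb_or => /and3P[? ? ?]; apply: c1 => //; have := ltn_ord i; lia.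
rewrite big1 ?mulr1 => [cc|j /andP[]].
  apply/eqP; rewrite -sqrp_eq1 ?expr2 ?cc //; apply/ltW/c0; have := ltn_ord i; lia.
rewrite -!val_eqE /= => ne1 ne2; apply: c1; move: mid ne; rewrite !inE -!val_eqE /=;
  have := ltn_ord j; have := ltn_ord i; lia.
Qed.

Lemma balanced_inv (R : realType) (n : nat) (d : 'rV[R]_n) :
  balanced d -> balanced (diag_inv d).
Proof. by move=> h i; rewrite !mxE -invfM h -signr_odd; case: odd; rewrite ?invrN1 ?invr1. Qed.

Lemma Nn_tildeP (R : realType) (n : nat) (M A B : 'M[R]_n) (d : 'rV[R]_n) :
  Nn_pos M -> bigcell M A B d -> Nn_tilde M <-> balanced d.
Proof.
move=> Mpos h; split=> [[_ [x [Mx hx]]]|db]; first exact/(balancedP h Mx).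
split => //; have [x Mx] := Nn_pos_coordinates Mpos.
by exists x; split => //; exact/(balancedP h Mx).
Qed.

Theorem proposition5 (R : realType) (n : nat) (hn : (2 <= n)%N) :
  (forall M : 'M[R]_n, Nn_tilde M ->
     Nn_tilde (mx_prime M) /\ Nn_tilde (mx_dprime M)) /\
  (forall M : 'M[R]_n, Nn_tilde M ->
     mx_prime (mx_dprime (mx_prime M)) = mx_dprime (mx_prime (mx_dprime M))).
Proof.
split=> M Mt; have [Mpos _] := Mt;
  have [A [B [d [h _ _]]]] := bigcell_exists Mpos; have db := (Nn_tildeP Mpos h).1 Mt;
  have [Apos Bpos] := bigcell_pos Mpos h;
  have h1 := bigcell_prime h; have h2 := bigcell_dprime h.
  rewrite (mx_prime_bigcell Mpos h) (mx_dprime_bigcell Mpos h).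
  by split; [apply/(Nn_tildeP Apos h1)|apply/(Nn_tildeP Bpos h2)]; exact: balanced_inv.
have [_ Epos] := bigcell_pos Apos h1; have [Cpos _] := bigcell_pos Bpos h2.
rewrite (mx_prime_bigcell Mpos h) (mx_dprime_bigcell Mpos h).
rewrite (mx_dprime_bigcell Apos h1) (mx_prime_bigcell Bpos h2).
rewrite (mx_prime_bigcell Epos (bigcell_dprime h1)).
rewrite (mx_dprime_bigcell Cpos (bigcell_prime h2)).
(* Both sides are now [invmx M] conjugated by diagonal matrices; balance expresses the reversed
   entries of [d] through [d] itself, and the signs cancel. *)
apply/matrixP => i j; rewrite !mul_mx_diag !mul_diag_mx !mxE.
have d0 := bigcell_neq0 h; have s0 := signr_eq0 R n.-1.
have dr k : d 0 (rev_ord k) = (-1) ^+ n.-1 / d 0 k by rewrite -(db k) mulrAC divff ?mul1r.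
by rewrite !dr !invrK; field; rewrite s0 !d0.
Qed.
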